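(* Let $m=m(n)$ be an integer-valued function of $n$ with $2\le m(n)\le n$, and consider the random game $G(m,n)$. Then: 1. $\lim_{n\to\infty}\Pr\left(S^R(m,n)<m\right)=0$ (for every such function $m=m(n)$). 2. If $m=o(\ln n)$, then $$\lim_{n\to\infty}\frac{(m-1)!}{(\ln n)^{m-1}}\cdot\mathbb{E}\left[S^C(m,n)\right]=1,$$ and therefore $\lim_{n\to\infty}\mathbb{E}\left[S^C(m,n)\right]/n=0$. 3. If $m=\log_2 n+\omega(1)$ (i.e. $m(n)-\log_2 n\to\infty$), then $\lim_{n\to\infty}\mathbb{E}\left[S^C(m,n)\right]/n=1$.
   Context: Random game $G(m,n)$ ($m,n\ge1$ integers): there are two players, Row with action set $[m]=\{1,\dots,m\}$ and Column with action set $[n]$. Payoffs are given by $m\times n$ matrices $R=(r_{ij})$ (Row's payoffs) and $C=(c_{ij})$ (Column's payoffs). For each $j\in[n]$ the column $r_{\cdot j}=(r_{1j},\dots,r_{mj})$ is a uniformly random permutation of $[m]$; for each $i\in[m]$ the row $c_{i\cdot}=(c_{i1},\dots,c_{in})$ is a uniformly random permutation of $[n]$; all these $m+n$ random permutations are mutually independent. Dominance (by pure actions only): in a (sub)game with row set $Y\subseteq[m]$ and column set $X\subseteq[n]$, Row's action $i\in Y$ is strictly dominated if there is $i'\in Y$ with $r_{i'x}>r_{ix}$ for all $x\in X$; Column's action $j\in X$ is strictly dominated if there is $j'\in X$ with $c_{yj'}>c_{yj}$ for all $y\in Y$. Iterated elimination: in each round, both players simultaneously delete all their actions that are strictly dominated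 in the current subgame; the procedure stops when there are no strictly dominated actions. $S^R(m,n)$ and $S^C(m,n)$ denote the (random) numbers of Row's and Column's actions, respectively, that survive this procedure in $G(m,n)$. *)

(* Defs.v *)
From mathcomp Require Import all_boot all_order all_fingroup all_algebra.
From mathcomp Require Import reals.
Import Order.TTheory GRing.Theory Num.Theory.

Set Implicit Arguments.
Unset Strict Implicit.
Unset Printing Implicit Defensive.

Local Open Scope ring_scope.

(* A realization of G(m, n): for every column j the permutation g.1 j giving
   Row's payoffs r_{.j}, and for every row i the permutation g.2 i giving
   Column's payoffs c_{i.}.  Actions are numbered from 0. *)
Definition game (m n : nat) : finType :=
  ({ffun 'I_n -> 'S_m} * {ffun 'I_m -> 'S_n})%type.

Definition row_payoff m n (g : game m n) (i : 'I_m) (j : 'I_n) : nat :=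
  (g.1 j i).+1.

Definition col_payoff m n (g : game m n) (i : 'I_m) (j : 'I_n) : nat :=
  (g.2 i j).+1.

Definition row_dominated m n (g : game m n) (Y : {set 'I_m}) (X : {set 'I_n})
    (i : 'I_m) : bool :=
  [exists i' in Y, forall x in X, (row_payoff g i x < row_payoff g i' x)%N].

Definition col_dominated m n (g : game m n) (Y : {set 'I_m}) (X : {set 'I_n})
    (j : 'I_n) : bool :=
  [exists j' in X, forall y in Y, (col_payoff g y j < col_payoff g y j')%N].

Definition elim_round m n (g : game m n) (S : {set 'I_m} * {set 'I_n}) :
    {set 'I_m} * {set 'I_n} :=
  ([set i in S.1 | ~~ row_dominated g S.1 S.2 i],
   [set j in S.2 | ~~ col_dominated g S.1 S.2 j]).

(* m + n rounds are enough for the procedure to stop, since every earlier round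
   deletes at least one action; see elim_round_survivors. *)
Definition survivors m n (g : game m n) : {set 'I_m} * {set 'I_n} :=
  iter (m + n) (elim_round g) ([set: 'I_m], [set: 'I_n]).

Lemma elim_round_survivors m n (g : game m n) :
  elim_round g (survivors g) = survivors g.
Proof.
pose N (S : {set 'I_m} * {set 'I_n}) := (#|S.1| + #|S.2|)%N.
have step S : elim_round g S = S \/ (N (elim_round g S) < N S)%N.
  case: S => Y X; rewrite /N /elim_round /=.
  set Y' := [set i in Y | _]; set X' := [set j in X | _].
  have sY : Y' \subset Y by apply/subsetP => i; rewrite inE => /andP[].
  have sX : X' \subset X by apply/subsetP => j; rewrite inE => /andP[].
  have [eY|nY] := eqVneq Y' Y.
    have [eX|nX] := eqVneq X' X; first by left; rewrite eY eX.
    right; rewrite eY ltn_add2l; apply: proper_card.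
    by rewrite properEneq nX.
  right; rewrite -addSn; apply: leq_add; last exact: subset_leq_card.
  by apply: proper_card; rewrite properEneq nY.
pose S0 := ([set: 'I_m], [set: 'I_n]).
have bound k : elim_round g (iter k (elim_round g) S0) = iter k (elim_round g) S0
    \/ (N (iter k (elim_round g) S0) + k <= m + n)%N.
  elim: k => [|k [IH|IH]].
  - by right; rewrite /N /= !cardsT !card_ord addn0.
  - by left; rewrite !iterS IH IH.
  - case: (step (iter k (elim_round g) S0)) => [e|lt].
      by left; rewrite !iterS e e.
    right; rewrite iterS addnS -addSn.
    by apply: leq_trans IH; rewrite leq_add2r.
rewrite /survivors -/S0; case: (bound (m + n)%N) => // le.
case: (step (iter (m + n) (elim_round g) S0)) => // lt.
have : (N (iter (m + n) (elim_round g) S0) <= 0)%N.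
  by rewrite -(leq_add2r (m + n)).
by rewrite leqNgt (leq_ltn_trans _ lt).
Qed.

Definition SR m n (g : game m n) : nat := #|(survivors g).1|.
Definition SC m n (g : game m n) : nat := #|(survivors g).2|.

Definition uniform_perm (R : realType) (k : nat) (s : 'S_k) : R :=
  #|'S_k|%:R^-1.

Definition game_law (R : realType) m n (g : game m n) : R :=
  (\prod_(j < n) uniform_perm R (g.1 j)) * (\prod_(i < m) uniform_perm R (g.2 i)).

Definition Prob (R : realType) m n (A : pred (game m n)) : R :=
  \sum_(g | A g) game_law R g.

Definition Expect (R : realType) m n (Z : game m n -> R) : R :=
  \sum_g game_law R g * Z g.

Lemma Prob_predT (R : realType) m n : Prob R (@predT (game m n)) = 1.
Proof.
have nz k : #|'S_k|%:R != 0 :> R.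
  by rewrite pnatr_eq0 -lt0n; apply/card_gt0P; exists 1%g.
rewrite /Prob (eq_bigr (fun=> (#|'S_m|%:R ^- n) * (#|'S_n|%:R ^- m) : R)).
  rewrite sumr_const -[_ *+ _]mulr_natr.
  have -> : #|(predT : pred (game m n))| = (#|'S_m| ^ n * #|'S_n| ^ m)%N.
    by rewrite card_prod !card_ffun !card_ord.
  rewrite natrM !natrX mulrACA !mulVf ?mulr1 //; apply: expf_neq0; exact: nz.
move=> g _; rewrite /game_law /uniform_perm !prodr_const !card_ord.
by rewrite !exprVn.
Qed.

(* Main.v *)
(* The columns surviving the first round are the undominated ones among n points
   of a random m-dimensional order, the maxima; they depend on C only.  If no
   row is dominated on this set, nothing more is ever deleted.  As R is
   independent of C, the failure probability given a set of maxima of size k is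
   at most m^2 2^-k.
   The mean number of maxima is the complete homogeneous polynomial h_(m-1) in
   1, 1/2, .., 1/n: conditionally on the rank k of a column in the first row,
   only the k columns above it compete in the other rows.  Since
   1/(1 - y) = (1 + y)/(1 - y^2) is dominated coefficientwise by e^y/(1 - y^2),
   h_m <= [z^m] e^(z H_n) / (1 - C_n z^2) with H_n = sum 1/k and
   C_n = sum 1/k^2, whence h_m ~ (ln n)^m / m! when m = o(ln n).
   The mean of 2^-k is at most n^(-1/2), by counting the maxima of two rows only
   (the records of a random permutation), which suffices for m^8 <= n; for
   larger m, all columns are maxima with probability at least 1 - n^2 2^-m. *)
Require Import Defs.
From mathcomp Require Import all_boot all_order all_fingroup all_algebra.
From mathcomp Require Import all_classical all_reals all_analysis.
From mathcomp Require Import zify ring lra.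
Import Order.TTheory GRing.Theory Num.Theory.
Import numFieldNormedType.Exports.

Set Implicit Arguments.
Unset Strict Implicit.
Unset Printing Implicit Defensive.

Local Open Scope ring_scope.

(** * Averages over finite types *)

Definition avg (R : realType) (T : finType) (F : T -> R) : R :=
  (\sum_t F t) / #|T|%:R.

Lemma ler_avg (R : realType) (T : finType) (F G : T -> R) :
  (forall t, F t <= G t) -> avg F <= avg G.
Proof. by move=> FG; rewrite ler_wpM2r ?invr_ge0 ?ler_sum. Qed.

Lemma eq_avg (R : realType) (T : finType) (F G : T -> R) :
  F =1 G -> avg F = avg G.
Proof. by move=> FG; rewrite /avg (eq_bigr G). Qed.

Lemma avgD (R : realType) (T : finType) (F G : T -> R) :
  avg (fun t => F t + G t) = avg F + avg G.
Proof. by rewrite /avg big_split mulrDl. Qed.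

Lemma avgZ (R : realType) (T : finType) (c : R) (F : T -> R) :
  avg (fun t => c * F t) = c * avg F.
Proof. by rewrite /avg -mulr_sumr mulrA. Qed.

Lemma avg_cst (R : realType) (T : finType) (t0 : T) (c : R) :
  avg (fun _ : T => c) = c.
Proof.
rewrite /avg sumr_const -[c *+ _]mulr_natr mulfK // pnatr_eq0 -lt0n.
by apply/card_gt0P; exists t0.
Qed.

Lemma avg_sum (R : realType) (T I : finType) (P : pred I) (F : I -> T -> R) :
  avg (fun t => \sum_(i | P i) F i t) = \sum_(i | P i) avg (F i).
Proof. by rewrite /avg exchange_big mulr_suml. Qed.

Lemma avg_bij (R : realType) (T U : finType) (h : T -> U) (F : U -> R) :
  injective h -> #|U| = #|T| -> avg F = avg (F \o h).
Proof.
move=> hI eUT; rewrite /avg eUT; congr (_ / _).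
by rewrite (reindex h) //; apply: onW_bij; apply: inj_card_bij; rewrite ?eUT.
Qed.

Lemma avg_pair (R : realType) (T U : finType) (F : T * U -> R) :
  avg F = avg (fun t => avg (fun u => F (t, u))).
Proof.
rewrite /avg card_prod natrM invfM -mulr_suml pair_bigA -!mulrA.
rewrite [_^-1 * _]mulrC; congr (_ * _).
by apply: eq_bigr => -[].
Qed.

Lemma avgC (R : realType) (T U : finType) (F : T -> U -> R) :
  avg (fun t => avg (F t)) = avg (fun u => avg (F^~ u)).
Proof.
by rewrite /avg -!mulr_suml exchange_big /= -!mulrA [_^-1 * _]mulrC.
Qed.

Definition ffun_cons (T : finType) (m : nat) (p : T * {ffun 'I_m -> T}) :
    {ffun 'I_m.+1 -> T} :=
  [ffun i => if unlift ord0 i is Some i' then p.2 i' else p.1].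

Lemma avg_ffun_cons (R : realType) (T : finType) (m : nat)
    (F : {ffun 'I_m.+1 -> T} -> R) :
  avg F = avg (fun s => avg (fun f : {ffun 'I_m -> T} => F (ffun_cons (s, f)))).
Proof.
rewrite (@avg_bij _ _ _ (@ffun_cons T m)) ?avg_pair //.
  move=> [s f] [t g] /ffunP e; congr (_, _).
    by have := e ord0; rewrite !ffunE unlift_none.
  by apply/ffunP => i; have := e (lift ord0 i); rewrite !ffunE liftK.
by rewrite card_prod !card_ffun !card_ord expnS.
Qed.

(** A permutation of n+1 points amounts to the image j of the first point together with the pattern
    s of the others; the two are independent and uniform. *)
Lemma avg_perm_lift (R : realType) (n : nat) (F : 'S_n.+1 -> R) :
  avg F = avg (fun j => avg (fun s => F (lift_perm ord0 j s))).
Proof.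
rewrite (@avg_bij _ _ _ (fun p => lift_perm ord0 p.1 p.2)) ?avg_pair //.
  move=> [j s] [k t] /= /permP e.
  have ejk : j = k by have := e ord0; rewrite !lift_perm_id.
  congr (_, _) => //; apply/permP => i.
  by have := e (lift ord0 i); rewrite !lift_perm_lift ejk => /lift_inj.
by rewrite card_prod card_ord !card_Sn factS.
Qed.

(** Column's payoffs are averaged outside and Row's inside, so that the set of maxima is fixed while
    Row's permutations vary. *)
Lemma game_avg (R : realType) (m n : nat) (Z : game m n -> R) :
  Expect Z = avg (fun f => avg (fun h => Z (h, f))).
Proof.
rewrite avgC -(avg_pair Z) /Expect /avg mulr_suml; apply: eq_bigr => g _.
rewrite mulrC; congr (_ * _).
rewrite /game_law /uniform_perm !prodr_const !card_ord card_prod !card_ffun.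
by rewrite !card_ord natrM !natrX invfM !exprVn.
Qed.

Lemma Prob_Expect (R : realType) (m n : nat) (A : pred (game m n)) :
  Prob R A = Expect (fun g => (A g)%:R).
Proof.
rewrite /Prob /Expect big_mkcond; apply: eq_bigr => g _.
by case: (A g); rewrite ?mulr1 ?mulr0.
Qed.

(** Composition with the transposition of i and i' preserves the uniform law and exchanges the two
    strict inequalities, exactly one of which holds. *)
Lemma avg_perm_lt (R : realType) (k : nat) (i i' : 'I_k) : i != i' ->
  avg (fun s : 'S_k => (s i < s i')%N%:R) = 2^-1 :> R.
Proof.
move=> ii'; set a := avg _.
have e : a = avg (fun s : 'S_k => (s i' < s i)%N%:R).
  rewrite /a (@avg_bij _ _ _ (mulg (tperm i i'))) //; last exact: mulgI.
  by apply: eq_avg => s /=; rewrite !permM tpermL tpermR.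
have : a + a = 1.
  rewrite {2}e /a -avgD -[RHS](avg_cst (1%g : 'S_k)).
  apply: eq_avg => s; have : s i != s i' by rewrite (inj_eq perm_inj).
  by rewrite -val_eqE /=; case: ltngtP => // _ _; rewrite ?addr0 ?add0r.
lra.
Qed.

(* For i = i' the event is X = set0, so the bound still holds. *)
Lemma avg_dominates (R : realType) (I : finType) (k : nat) (X : {set I})
    (i i' : 'I_k) :
  avg (fun f : {ffun I -> 'S_k} => [forall x in X, (f x i < f x i')%N]%:R)
    <= (2^-1 : R) ^+ #|X|.
Proof.
have [<-|ii'] := eqVneq i i'.
  have [->|[x xX]] := set_0Vmem X.
    rewrite cards0 expr0 -[leRHS](avg_cst [ffun _ : I => 1%g : 'S_k]).
    by apply: ler_avg => f; rewrite lern1 leq_b1.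
  apply: (@le_trans _ _ 0); last by rewrite exprn_ge0 ?invr_ge0.
  rewrite -[leRHS](avg_cst [ffun _ : I => 1%g : 'S_k]).
  apply: ler_avg => f; case: forallP => // /(_ x).
  by rewrite xX ltnn.
(* The indicator is a product of factors [G x (f x)], each depending on one permutation; by
   independence its mean is the product of the means, 1/2 on X and 1 elsewhere. *)
pose G x (s : 'S_k) : R := if x \in X then (s i < s i')%N%:R else 1.
have -> : avg (fun f : {ffun I -> 'S_k} => [forall x in X, (f x i < f x i')%N]%:R)
    = avg (fun f : {ffun I -> 'S_k} => \prod_x G x (f x)).
  apply: eq_avg => f; case: forallP => [h|/forallP].
    rewrite big1 // => x _; rewrite /G; case: ifP => // xX.
    by move: (h x); rewrite xX /= => ->.
  rewrite negb_forall => /existsP[x]; rewrite negb_imply => /andP[xX h].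
  by rewrite (bigD1 x) //= /G xX (negbTE h) mul0r.
have -> : avg (fun f : {ffun I -> 'S_k} => \prod_x G x (f x)) = \prod_x avg (G x).
  by rewrite prodf_div prodr_const /avg -bigA_distr_bigA card_ffun natrX.
rewrite -prodr_const [leRHS]big_mkcond le_eqVlt; apply/orP; left; apply/eqP.
apply: eq_bigr => x _.
rewrite /G; case: ifP => _; first exact: avg_perm_lt.
by rewrite (avg_cst (1%g : 'S_k)).
Qed.

(** * Undominated columns *)

(** The disjunct [j' == j] settles the case of no rows, where all comparisons hold vacuously: j is
    then undominated exactly if X has no other element. The recursion on rows ends there. *)
Definition undominated (m n : nat) (f : {ffun 'I_m -> 'S_n}) (X : {set 'I_n})
    (j : 'I_n) : bool :=
  [forall j' in X, (j' == j) || ~~ [forall i, (f i j < f i j')%N]].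

(** The weak inequality keeps j itself, so for j in X the cardinality is the rank of j in X counted
    from the top. *)
Definition upper (n : nat) (s : 'S_n) (X : {set 'I_n}) (j : 'I_n) : {set 'I_n} :=
  [set j' in X | (s j <= s j')%N].

(** A competitor dominates j exactly if it beats j in the row s, hence lies in [upper s X j], and
    dominates j in the remaining rows. *)
Lemma undominated_cons (m n : nat) (s : 'S_n) (f : {ffun 'I_m -> 'S_n})
    (X : {set 'I_n}) (j : 'I_n) :
  undominated (ffun_cons (s, f)) X j = undominated f (upper s X j) j.
Proof.
apply: eq_forallb => j'; rewrite inE; case: (j' \in X) => //=.
have [->|j'j] := eqVneq j' j; first by rewrite implybT.
have sj : (s j <= s j')%N = (s j < s j')%N.
  by rewrite leq_eqVlt val_eqE (inj_eq perm_inj) eq_sym (negbTE j'j).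
rewrite sj implybE -negb_and; congr (~~ _); apply/forallP/andP => [h|[h0 /forallP h] i].
  split; first by have := h ord0; rewrite !ffunE unlift_none.
  by apply/forallP => i; have := h (lift ord0 i); rewrite !ffunE liftK.
by rewrite !ffunE; case: unliftP.
Qed.

Lemma sum_card_upper (R : realType) (n : nat) (s : 'S_n) (phi : nat -> R)
    (X : {set 'I_n}) :
  \sum_(j in X) phi #|upper s X j| = \sum_(k < #|X|) phi k.+1.
Proof.
move Ex : #|X| => x; elim: x X Ex => [|x IH] X Ex.
  by rewrite big_ord0 big_pred0 // => j; rewrite (cards0_eq Ex) inE.
have /card_gt0P[j1 j1X] : (0 < #|X|)%N by rewrite Ex.
(* The lowest element j0 has all of X as its upper set and lies in no other upper set, so removing
   it leaves the other ranks unchanged. *)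
case: (@arg_minnP _ j1 (mem X) (fun j => s j : nat) j1X) => j0 j0mem minj0.
have j0X : j0 \in X := j0mem.
have Ex' : #|X :\ j0| = x by have := cardsD1 j0 X; rewrite j0X Ex => -[].
rewrite (big_setD1 j0) //= big_ord_recr /= addrC -(IH _ Ex'); congr (_ + _).
  apply: eq_bigr => j; rewrite !inE => /andP[jj0 jX]; congr (phi #|pred_of_set _|).
  apply/setP => j'; rewrite !inE; have [->|//] := eqVneq j' j0.
  rewrite j0X /=; apply/negbTE; rewrite -ltnNge ltn_neqAle minj0 // andbT.
  by rewrite val_eqE (inj_eq perm_inj) eq_sym.
congr (phi _); rewrite -Ex; congr #|pred_of_set _|; apply/setP => j'.
by rewrite inE; apply: andb_idr => /minj0.
Qed.

(* Exchangeability: the rank of j among X under a random permutation is uniform. *)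
Lemma avg_card_upper (R : realType) (n : nat) (phi : nat -> R)
    (X : {set 'I_n}) (j : 'I_n) : j \in X ->
  avg (fun s : 'S_n => phi #|upper s X j|) = (\sum_(k < #|X|) phi k.+1) / #|X|%:R.
Proof.
move=> jX; have X0 : #|X|%:R != 0 :> R.
  by rewrite pnatr_eq0 -lt0n; apply/card_gt0P; exists j.
have exch j' : j' \in X ->
    avg (fun s : 'S_n => phi #|upper s X j'|) = avg (fun s => phi #|upper s X j|).
  (* The transposition of j and j' maps X to itself and carries one upper set to the other. *)
  move=> j'X; rewrite (@avg_bij _ _ _ (mulg (tperm j j'))) //; last exact: mulgI.
  apply: eq_avg => s /=; congr phi.
  rewrite -(card_preimset (upper s X j) (@perm_inj _ (tperm j j'))).
  congr #|pred_of_set _|; apply/setP => x; rewrite !inE !permM tpermR.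
  by congr (_ && _); case: tpermP => [->|->|//]; rewrite jX j'X.
apply: (canRL (mulfK X0)); rewrite mulr_natr -sumr_const.
rewrite (eq_bigr (fun j' => avg (fun s : 'S_n => phi #|upper s X j'|))); last first.
  by move=> j' /exch.
rewrite -avg_sum -[RHS](avg_cst (1%g : 'S_n)); apply: eq_avg => s.
exact: sum_card_upper.
Qed.

(* The complete homogeneous symmetric polynomial of degree m in 1, 1/2, .., 1/n. *)
Fixpoint pareto_mean (R : realType) (m n : nat) : R :=
  if m is m'.+1 then \sum_(k < n) pareto_mean R m' k.+1 / k.+1%:R else 1.

(** Given the first row, j competes only within its upper set, whose size is uniform on 1, .., |X|;
    averaging the induction hypothesis over this size is the recursion of [pareto_mean]. *)
Lemma avg_undominated (R : realType) (m n : nat) (X : {set 'I_n}) (j : 'I_n) :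
  j \in X ->
  avg (fun f : {ffun 'I_m.+1 -> 'S_n} => (undominated f X j)%:R)
    = pareto_mean R m #|X| / #|X|%:R.
Proof.
elim: m X => [|m IH] X jX; rewrite avg_ffun_cons.
  (* With a single row, j is undominated exactly if it has rank 1. *)
  pose phi k : R := (k == 1%N)%:R.
  have e (s : 'S_n) (f : {ffun 'I_0 -> 'S_n}) :
      (undominated (ffun_cons (s, f)) X j)%:R = phi #|upper s X j|.
    congr (_ %:R); congr nat_of_bool; rewrite undominated_cons.
    have jU : j \in upper s X j by rewrite inE jX /=.
    apply/forallP/cards1P => [h|[j1 Uj1] j'].
      exists j; apply/setP => j'; rewrite inE; apply/idP/eqP => [j'U|->//].
      move: (h j'); rewrite j'U /= => /orP[/eqP //|/negP[]].
      by apply/forallP => -[].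
    by move: jU; rewrite Uj1 !inE => /eqP ->; apply/implyP => ->.
  rewrite (eq_avg (G := fun s => phi #|upper s X j|)); last first.
    by move=> s; rewrite -[RHS](avg_cst [ffun _ : 'I_0 => 1%g : 'S_n]);
      apply: eq_avg => f; exact: e.
  rewrite avg_card_upper //=; congr (_ / _).
  case: #|X| (cardsD1 j X) => [|x _]; first by rewrite jX.
  by rewrite big_ord_recl big1 ?addr0.
rewrite (eq_avg (G := fun s => (fun k => pareto_mean R m k / k%:R) #|upper s X j|)).
  exact: (avg_card_upper (fun k => pareto_mean R m k / k%:R) jX).
move=> s; rewrite -IH ?inE ?jX //=.
by apply: eq_avg => f; rewrite undominated_cons.
Qed.

Definition maxima (m n : nat) (f : {ffun 'I_m -> 'S_n}) : {set 'I_n} :=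
  [set j | undominated f [set: 'I_n] j].

Lemma card_sum (R : realType) (T : finType) (A : {set T}) :
  #|A|%:R = \sum_t (t \in A)%:R :> R.
Proof. by rewrite -sum1_card natr_sum big_mkcond; apply: eq_bigr => t _; case: ifP. Qed.

Lemma avg_card_maxima (R : realType) (m n : nat) : (0 < n)%N ->
  avg (fun f : {ffun 'I_m.+1 -> 'S_n} => #|maxima f|%:R) = pareto_mean R m n.
Proof.
move=> n0.
rewrite (eq_avg (G := fun f => \sum_j (undominated f [set: 'I_n] j)%:R)); last first.
  by move=> f; rewrite card_sum; apply: eq_bigr => j _; rewrite inE.
rewrite avg_sum (eq_bigr (fun=> pareto_mean R m n / n%:R)); last first.
  by move=> j _; rewrite avg_undominated ?inE // cardsT card_ord.
by rewrite sumr_const card_ord -[(_ / _) *+ _]mulr_natr divfK // pnatr_eq0 -lt0n.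
Qed.

(** Union bound over ordered pairs of columns: one beats the other in all m independent rows with
    probability at most 2^-m. *)
Lemma avg_non_maxima (R : realType) (m n : nat) :
  avg (fun f : {ffun 'I_m -> 'S_n} => n%:R - #|maxima f|%:R)
    <= n%:R ^+ 2 * (2^-1 : R) ^+ m.
Proof.
pose D (f : {ffun 'I_m -> 'S_n}) j j' : R := [forall i in [set: 'I_m], (f i j < f i j')%N]%:R.
have le f : n%:R - #|maxima f|%:R <= \sum_(j < n) \sum_(j' < n) D f j j'.
  have -> : n%:R = \sum_(j < n) 1 :> R by rewrite sumr_const card_ord.
  rewrite card_sum -sumrB; apply: ler_sum => j _; rewrite inE.
  case: (boolP (undominated f _ j)) => [_|/forallPn[j']].
    by rewrite subrr sumr_ge0.
  rewrite inE /= => /norP[_ /negPn /forallP dom]; rewrite subr0 (bigD1 j') //=.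
  have -> : D f j j' = 1.
    by rewrite /D (_ : [forall _ in _, _]) //; apply/forallP => i; rewrite dom implybT.
  by rewrite lerDl sumr_ge0.
apply: le_trans (ler_avg le) _.
rewrite avg_sum; under eq_bigr do rewrite avg_sum.
apply: (@le_trans _ _ (\sum_(j < n) \sum_(j' < n) (2^-1 : R) ^+ m)).
  apply: ler_sum => j _; apply: ler_sum => j' _.
  by have := avg_dominates R [set: 'I_m] j j'; rewrite cardsT card_ord.
by rewrite !sumr_const card_ord -mulrnA expr2 -natrM mulr_natl.
Qed.

(** * Records (right-to-left maxima) of a random permutation *)

Definition records (n : nat) (u : 'S_n) : {set 'I_n} :=
  [set k : 'I_n | [forall k' : 'I_n, (k < k')%N ==> (u k' < u k)%N]].

(** The new point comes first, so it does not affect whether later positions are records; it is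
    itself a record only if its value is the top one. *)
Lemma card_records_lift (n : nat) (j : 'I_n.+1) (v : 'S_n) :
  #|records (lift_perm ord0 j v)| = ((j == ord_max) + #|records v|)%N.
Proof.
rewrite -!sum1dep_card big_mkcond big_ord_recl /=; congr (_ + _)%N.
  rewrite lift_perm_id; have [->|jmax] := eqVneq.
    case: forallP => // -[] k; apply/implyP.
    case: (unliftP ord0 k) => [i ->|-> //] _.
    by rewrite lift_perm_lift lift_max.
  (* The position of the top value refutes the claim that position 0 is a record, unless the two
     positions coincide. *)
  case: forallP => // /(_ ((lift_perm ord0 j v)^-1%g ord_max)).
  rewrite permKV [X in _ ==> X]ltnNge leq_ord implybF -eqn0Ngt.
  move=> /eqP e; case/eqP: jmax; rewrite -[RHS](permKV (lift_perm ord0 j v)).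
  by rewrite (_ : _ ord_max = ord0) ?lift_perm_id //; apply: val_inj.
rewrite [RHS]big_mkcond; apply: eq_bigr => k _; congr (if _ then _ else _).
have lt_lift (h : 'I_n.+1) (x y : 'I_n) : (lift h x < lift h y)%N = (x < y)%N.
  by rewrite !ltnNge /= leq_bump2.
apply/forallP/forallP => h k'.
  by have := h (lift ord0 k'); rewrite !lift_perm_lift !lt_lift.
by case: (unliftP ord0 k') => [i ->|->//]; rewrite !lift_perm_lift !lt_lift; exact: h.
Qed.

Definition records_pgf (R : realType) (n : nat) : R :=
  avg (fun u : 'S_n => 2^-1 ^+ #|records u|).

(** The first position is a record with probability 1/(n+1), independently of the rest, which gives
    the factor 1 - 1/(n+1) + (1/2)/(n+1). *)
Lemma records_pgfS (R : realType) (n : nat) :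
  records_pgf R n.+1 = (1 - (2 * n.+1%:R)^-1) * records_pgf R n.
Proof.
rewrite /records_pgf avg_perm_lift.
pose c (j : 'I_n.+1) : R := 2^-1 ^+ (j == ord_max).
rewrite (eq_avg (G := fun j => records_pgf R n * c j)); last first.
  move=> j; rewrite mulrC -avgZ; apply: eq_avg => v.
  by rewrite card_records_lift exprD.
rewrite avgZ mulrC; congr (_ * _).
rewrite /avg card_ord (bigD1 ord_max) //= (eq_bigr (fun=> 1)); last first.
  by move=> j /negbTE; rewrite /c => ->.
rewrite /c eqxx expr1 sumr_const cardC1 card_ord /= (_ : 1 *+ n = n.+1%:R - 1).
  by field; rewrite nat1r pnatr_eq0.
by rewrite -natr1 addrK.
Qed.

(** Squaring turns the bound (n+1)^(-1/2) into a rational one, and the induction reduces to (1 -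
    1/(2x))^2 / x <= 1/(x+1). *)
Lemma records_pgf_sqr (R : realType) (n : nat) :
  records_pgf R n ^+ 2 <= n.+1%:R^-1.
Proof.
elim: n => [|n IH].
  rewrite invr1 expr_le1 // /records_pgf.
    by rewrite -[leRHS](avg_cst (1%g : 'S_0)); apply: ler_avg => u; rewrite exprn_ile1 ?invf_le1 ?ler1n.
  by rewrite mulr_ge0 ?invr_ge0 ?sumr_ge0 // => u _; rewrite exprn_ge0.
rewrite records_pgfS exprMn.
apply: le_trans (ler_wpM2l (sqr_ge0 _) IH) _.
rewrite -(natr1 n.+1); set x : R := n.+1%:R.
have x1 : 1 <= x by rewrite ler1n.
have x0 : x != 0 by lra.
have -> : (1 - (2 * x)^-1) ^+ 2 / x = (x + 1)^-1 - (3 * x - 1) / (4 * x ^+ 3 * (x + 1)).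
  by field; apply/andP; split; lra.
rewrite gerBl divr_ge0 //; first lra.
by rewrite !mulr_ge0 ?exprn_ge0 //; lra.
Qed.

(** With columns ordered by their value in row s, row t reads [s^-1 * t]. A record there is beaten
    by no column in both rows, hence by none in all rows. *)
Lemma card_records_maxima (m n : nat) (s t : 'S_n) (f : {ffun 'I_m -> 'S_n}) :
  (#|records (s^-1 * t)%g| <= #|maxima (ffun_cons (s, ffun_cons (t, f)))|)%N.
Proof.
rewrite -(card_preimset _ (@perm_inj _ s)); apply/subset_leq_card/fintype.subsetP => j.
rewrite !inE !undominated_cons => /forallP rec.
apply/forallP => j'; rewrite !inE; apply/implyP => /andP[/= sj tj].
apply/orP; left; apply: contraT => j'j.
have := rec (s j'); rewrite !permM !permK ltn_neqAle sj val_eqE.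
by rewrite (inj_eq perm_inj) eq_sym j'j /= ltnNge tj.
Qed.

Lemma avg_pgf_maxima (R : realType) (m n : nat) :
  avg (fun f : {ffun 'I_m.+2 -> 'S_n} => (2^-1 : R) ^+ #|maxima f|) <= records_pgf R n.
Proof.
rewrite avg_ffun_cons -[leRHS](avg_cst (1%g : 'S_n)); apply: ler_avg => s.
(* For fixed s the permutation [s^-1 * t] is as uniform as t. *)
rewrite avg_ffun_cons /records_pgf [leRHS](@avg_bij _ _ _ (mulg s^-1%g)) //; last exact: mulgI.
apply: ler_avg => t /=; rewrite -[leRHS](avg_cst [ffun _ : 'I_m => 1%g : 'S_n]).
apply: ler_avg => f; apply: ler_wiXn2l; rewrite ?invr_ge0 ?invf_le1 ?ler1n //.
exact: card_records_maxima.
Qed.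

(** * Elimination rounds *)

Definition some_row_dominated (m n : nat) (h : {ffun 'I_n -> 'S_m})
    (X : {set 'I_n}) : bool :=
  [exists i, exists i', forall x in X, (h x i < h x i')%N].

Lemma avg_some_row_dominated (R : realType) (m n : nat) (X : {set 'I_n}) :
  avg (fun h : {ffun 'I_n -> 'S_m} => (some_row_dominated h X)%:R)
    <= m%:R ^+ 2 * (2^-1 : R) ^+ #|X|.
Proof.
pose D (h : {ffun 'I_n -> 'S_m}) i i' : R := [forall x in X, (h x i < h x i')%N]%:R.
have le h : (some_row_dominated h X)%:R <= \sum_i \sum_i' D h i i'.
  case: (boolP (some_row_dominated h X)) => [/existsP[i /existsP[i' dom]]|_].
    rewrite (bigD1 i) //= (bigD1 i') //= {1}/D dom -addrA lerDl.
    by rewrite addr_ge0 ?sumr_ge0 // => *; rewrite sumr_ge0.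
  by rewrite sumr_ge0 // => *; rewrite sumr_ge0.
apply: le_trans (ler_avg le) _.
rewrite avg_sum; under eq_bigr do rewrite avg_sum.
apply: (@le_trans _ _ (\sum_(i < m) \sum_(i' < m) (2^-1 : R) ^+ #|X|)).
  by apply: ler_sum => i _; apply: ler_sum => i' _; exact: avg_dominates.
by rewrite !sumr_const card_ord -mulrnA expr2 -natrM mulr_natl.
Qed.

(** A row must exist: without rows each column would dominate itself under [col_dominated], whereas
    [undominated] sets the case j' = j aside. *)
Lemma elim_round_init (m n : nat) (g : game m n) : (0 < m)%N ->
  (elim_round g ([set: 'I_m], [set: 'I_n])).2 = maxima g.2.
Proof.
move=> m0; apply/setP => j; rewrite !inE /=.
apply/idP/forallP => [h j'|h].
  apply/implyP => _; apply/orP; right; apply: contra h => /forallP h.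
  by apply/existsP; exists j'; rewrite inE; apply/forallP => y; rewrite inE /= ltnS h.
apply/negP => /existsP[j' /andP[_ /forallP dom]].
have := h j'; rewrite inE /= => /orP[/eqP e|/negP[]].
  by have := dom (Ordinal m0); rewrite e inE ltnn.
by apply/forallP => i; have := dom i; rewrite inE /= ltnS.
Qed.

Lemma SC_le_maxima (m n : nat) (g : game m n) : (0 < m)%N ->
  (SC g <= #|maxima g.2|)%N.
Proof.
case: m g => // m g _; rewrite -elim_round_init //; apply: subset_leq_card.
rewrite /survivors addSn iterSr; elim: (m + n)%N => [|k IH] //=.
by apply: fintype.subset_trans IH; apply/fintype.subsetP => j; rewrite inE => /andP[].
Qed.

(** A row dominated on a larger column set is dominated on the maxima, so no row is ever deleted;
    with all rows present, the maxima stay mutually undominated and the second round changes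
    nothing. *)
Lemma survivors_all_rows (m n : nat) (g : game m n) : (0 < m)%N ->
  ~~ some_row_dominated g.1 (maxima g.2) ->
  survivors g = ([set: 'I_m], maxima g.2).
Proof.
move=> m0 nodom.
have rows (X : {set 'I_n}) : maxima g.2 \subset X -> (elim_round g ([set: 'I_m], X)).1 = [set: 'I_m].
  move=> /fintype.subsetP sX; apply/setP => i; rewrite !inE /=.
  apply: contra nodom => /existsP[i' /andP[_ /forallP dom]].
  apply/existsP; exists i; apply/existsP; exists i'; apply/forallP => x.
  by apply/implyP => /sX xX; have := dom x; rewrite xX /= ltnS.
have r0 : elim_round g ([set: 'I_m], [set: 'I_n]) = ([set: 'I_m], maxima g.2).
  rewrite [LHS]surjective_pairing elim_round_init // rows // finset.subsetT.
have r1 : elim_round g ([set: 'I_m], maxima g.2) = ([set: 'I_m], maxima g.2).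
  rewrite [LHS]surjective_pairing rows ?subxx //; congr (_, _).
  apply/setP => j; rewrite inE /=; apply: andb_idr.
  rewrite -elim_round_init // inE => /andP[_]; apply: contra.
  move=> /existsP[j' /andP[_ dom]].
  by apply/existsP; exists j'; rewrite inE.
case: m g m0 {nodom rows} r0 r1 => // m g _ r0 r1.
by rewrite /survivors addSn iterSr r0; elim: (m + n)%N => //= k ->.
Qed.

(** The union bound m^2 2^-k on the event that some row is dominated on k maxima, averaged over
    Column's payoffs. *)
Definition row_loss (R : realType) (m n : nat) : R :=
  m%:R ^+ 2 * avg (fun f : {ffun 'I_m -> 'S_n} => 2^-1 ^+ #|maxima f|).

Lemma Prob_SR_lt (R : realType) (m n : nat) : (0 < m)%N ->
  Prob R (fun g : game m n => (SR g < m)%N) <= row_loss R m n.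
Proof.
move=> m0; rewrite Prob_Expect game_avg /row_loss -avgZ; apply: ler_avg => f.
apply: le_trans _ (avg_some_row_dominated R m (maxima f)); apply: ler_avg => h.
rewrite ler_nat; case: ltnP => // lt; rewrite lt0b; apply: contraTT lt => nodom.
by rewrite /SR survivors_all_rows //= cardsT card_ord ltnn.
Qed.

Lemma Expect_SC_le (R : realType) (m n : nat) : (0 < n)%N ->
  Expect (fun g : game m.+1 n => (SC g)%:R) <= pareto_mean R m n.
Proof.
move=> n0; rewrite -avg_card_maxima // game_avg; apply: ler_avg => f.
rewrite -[leRHS](avg_cst [ffun _ : 'I_n => 1%g : 'S_m.+1]); apply: ler_avg => h.
by rewrite ler_nat; exact: SC_le_maxima.
Qed.

Lemma Expect_SC_ge (R : realType) (m n : nat) : (0 < m)%N ->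
  avg (fun f : {ffun 'I_m -> 'S_n} =>
         #|maxima f|%:R * (1 - m%:R ^+ 2 * 2^-1 ^+ #|maxima f|))
    <= Expect (fun g : game m n => (SC g)%:R) :> R.
Proof.
move=> m0; rewrite game_avg; apply: ler_avg => f; set k := #|maxima f|.
pose h0 : {ffun 'I_n -> 'S_m} := [ffun=> 1%g].
apply: (@le_trans _ _ (avg (fun h : {ffun 'I_n -> 'S_m} =>
    k%:R * (1 + -1 * (some_row_dominated h (maxima f))%:R)))).
  rewrite avgZ ler_wpM2l // avgD avgZ (avg_cst h0) mulN1r lerD2l lerN2.
  exact: avg_some_row_dominated.
apply: ler_avg => h; case: (boolP (some_row_dominated _ _)) => dom.
  by rewrite mulr1 subrr mulr0.
by rewrite mulr0 addr0 mulr1 /SC survivors_all_rows.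
Qed.

(** Since k 2^-k <= 1, the k maxima lost with probability at most (m+1)^2 2^-k cost at most (m+1)^2
    on average. *)
Lemma Expect_SC_ge_pareto (R : realType) (m n : nat) : (0 < n)%N ->
  pareto_mean R m n - m.+1%:R ^+ 2 <= Expect (fun g : game m.+1 n => (SC g)%:R).
Proof.
move=> n0; apply: le_trans _ (Expect_SC_ge R n (ltn0Sn m)).
pose f0 : {ffun 'I_m.+1 -> 'S_n} := [ffun=> 1%g].
rewrite -avg_card_maxima // -(avg_cst f0 (_ ^+ 2)) -mulN1r -avgZ -avgD.
apply: ler_avg => f; set k := #|_|; rewrite mulrBr mulr1 mulN1r lerD2l lerN2.
rewrite (avg_cst f0) mulrCA ler_piMr ?exprn_ge0 // exprVn ler_pdivrMr ?exprn_gt0 // mul1r.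
by rewrite -natrX ler_nat ltnW // ltn_expl.
Qed.

Lemma Expect_SC_ge_card (R : realType) (m n : nat) : (0 < m)%N ->
  n%:R - n%:R ^+ 2 * 2^-1 ^+ m - n%:R * row_loss R m n
    <= Expect (fun g : game m n => (SC g)%:R).
Proof.
move=> m0; apply: le_trans _ (Expect_SC_ge R n m0).
pose f0 : {ffun 'I_m -> 'S_n} := [ffun=> 1%g].
apply: (@le_trans _ _ (n%:R + -1 * avg (fun f : {ffun 'I_m -> 'S_n} =>
    n%:R - #|maxima f|%:R) + - n%:R * row_loss R m n)).
  by rewrite mulN1r mulNr lerD2r lerD2l lerN2; exact: avg_non_maxima.
rewrite /row_loss -(avg_cst f0 n%:R) -!avgZ -!avgD (avg_cst f0 n%:R).
apply: ler_avg => f; set e := 2^-1 ^+ _.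
have : #|maxima f|%:R <= n%:R :> R.
  by rewrite ler_nat -[leqRHS](card_ord n) max_card.
have : 0 <= m%:R ^+ 2 * e by rewrite mulr_ge0 ?exprn_ge0 ?invr_ge0.
nra.
Qed.

Lemma row_loss_le_records (R : realType) (m n : nat) : (2 <= m)%N ->
  row_loss R m n <= m%:R ^+ 2 * records_pgf R n.
Proof.
by case: m => [|[|m]] // _; rewrite ler_wpM2l ?exprn_ge0 //; exact: avg_pgf_maxima.
Qed.

(** For k maxima, 2^-k <= 2^-n + (n - k): either k = n, or n - k is at least 1. *)
Lemma row_loss_le_card (R : realType) (m n : nat) :
  row_loss R m n <= m%:R ^+ 2 * (2^-1 ^+ n + n%:R ^+ 2 * 2^-1 ^+ m).
Proof.
rewrite ler_wpM2l ?exprn_ge0 //.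
pose f0 : {ffun 'I_m -> 'S_n} := [ffun=> 1%g].
apply: le_trans (lerD (lexx _) (avg_non_maxima R m n)).
rewrite -(avg_cst f0 (2^-1 ^+ n)) -avgD; apply: ler_avg => f.
have : (#|maxima f| <= n)%N by rewrite -[leqRHS](card_ord n) max_card.
rewrite leq_eqVlt => /orP[/eqP ->|lt]; first by rewrite subrr addr0.
apply: (@le_trans _ _ 1); first by rewrite exprn_ile1 ?invr_ge0 ?invf_le1 ?ler1n.
have : #|maxima f|%:R + 1 <= n%:R :> R by rewrite natr1 ler_nat.
have : 0 <= 2^-1 ^+ n :> R by rewrite exprn_ge0 ?invr_ge0.
lra.
Qed.

(** * Asymptotics of the mean number of maxima *)

Definition harm (R : realType) (n : nat) : R := \sum_(k < n) k.+1%:R^-1.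

Lemma harmS (R : realType) (n : nat) : harm R n.+1 = harm R n + n.+1%:R^-1.
Proof. by rewrite /harm big_ord_recr. Qed.

Lemma harm_ge0 (R : realType) (n : nat) : 0 <= harm R n.
Proof. by rewrite sumr_ge0 // => k _; rewrite invr_ge0. Qed.

Lemma ln_ratio_le (R : realType) (x y : R) : 0 < x -> 0 < y ->
  ln y - ln x <= y / x - 1.
Proof.
move=> x0 y0; rewrite -ln_div ?posrE //.
rewrite -{1}[y / x](subrK 1) addrC; apply: le_ln1Dx.
by rewrite ltrBrDr addNr divr_gt0.
Qed.

Lemma ln_succ_le_harm (R : realType) (n : nat) : ln n.+1%:R <= harm R n.
Proof.
elim: n => [|n IH]; first by rewrite ln1 /harm big_ord0.
rewrite harmS -(natr1 n.+1); move: IH; set x : R := n.+1%:R => IH.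
have x1 : 1 <= x by rewrite ler1n.
clearbody x.
have : ln (x + 1) - ln x <= x^-1.
  apply: le_trans (ln_ratio_le _ _) _; try lra.
  by have -> : (x + 1) / x - 1 = x^-1 by field; lra.
lra.
Qed.

Lemma harm_le_ln (R : realType) (n : nat) : harm R n.+1 <= 1 + ln n.+1%:R.
Proof.
elim: n => [|n IH]; first by rewrite ln1 addr0 harmS /harm big_ord0 add0r invr1.
rewrite harmS -(natr1 n.+1); move: IH; set x : R := n.+1%:R => IH.
have x1 : 1 <= x by rewrite ler1n.
clearbody x.
have : ln x - ln (x + 1) <= - (x + 1)^-1.
  apply: le_trans (ln_ratio_le _ _) _; try lra.
  have -> : x / (x + 1) = 1 - (x + 1)^-1 by field; lra.
  lra.
lra.
Qed.

Lemma harm_ln (R : realType) (n : nat) : (0 < n)%N ->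
  ln n%:R <= harm R n <= 1 + ln n%:R.
Proof.
case: n => // n _; rewrite harm_le_ln andbT harmS.
by rewrite (le_trans (ln_succ_le_harm R n)) // lerDl invr_ge0.
Qed.

(** The coefficient of z^m in e^(xz). *)
Definition exp_term (R : realType) (m : nat) (x : R) : R := x ^+ m / m`!%:R.

Lemma exp_term_ge0 (R : realType) (m : nat) (x : R) : 0 <= x -> 0 <= exp_term m x.
Proof. by move=> x0; rewrite divr_ge0 ?exprn_ge0. Qed.

Lemma exp_termS (R : realType) (m : nat) (x : R) :
  exp_term m.+1 x * m.+1%:R = x * exp_term m x.
Proof.
rewrite /exp_term factS natrM exprS; field.
by rewrite nat1r !pnatr_eq0 -lt0n fact_gt0.
Qed.

(** Coefficientwise, e^(yz) >= 1 + yz, multiplied by e^(xz). *)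
Lemma exp_termD_ge (R : realType) (m : nat) (x y : R) : 0 <= x -> 0 <= y ->
  exp_term m.+1 x + y * exp_term m x <= exp_term m.+1 (x + y).
Proof.
move=> x0 y0; elim: m => [|m IH].
  by rewrite /exp_term !expr1 expr0 fact0 !divr1 mulr1.
rewrite -(ler_pM2r (_ : 0 < m.+2%:R)) ?ltr0n // mulrDl !exp_termS.
have h0 := exp_term_ge0 m x0; have h1 := exp_term_ge0 m.+1 x0.
have e1 := exp_termS m x.
have -> : y * exp_term m.+1 x * m.+2%:R
    = y * exp_term m.+1 x + y * (exp_term m.+1 x * m.+1%:R).
  by rewrite -(natr1 m.+1); ring.
rewrite e1; apply: le_trans (ler_wpM2l (addr_ge0 x0 y0) IH).
rewrite -subr_ge0 (_ : _ - _ = y ^+ 2 * exp_term m x); last ring.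
by rewrite mulr_ge0 ?exprn_ge0.
Qed.

(** Coefficientwise, e^(yz) (1 - yz) <= 1, multiplied by e^(xz). *)
Lemma exp_termD_le (R : realType) (m : nat) (x y : R) : 0 <= x -> 0 <= y ->
  exp_term m.+1 (x + y) <= exp_term m.+1 x + y * exp_term m (x + y).
Proof.
move=> x0 y0; elim: m => [|m IH].
  by rewrite /exp_term !expr1 expr0 fact0 !divr1 mulr1.
rewrite -(ler_pM2r (_ : 0 < m.+2%:R)) ?ltr0n // mulrDl !exp_termS.
have e1 := exp_termS m (x + y).
have -> : y * exp_term m.+1 (x + y) * m.+2%:R
    = y * exp_term m.+1 (x + y) + y * (exp_term m.+1 (x + y) * m.+1%:R).
  by rewrite -(natr1 m.+1); ring.
rewrite e1 [leLHS]mulrDl [y * (_ * _)]mulrCA.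
have := ler_wpM2l x0 IH; have := ler_wpM2l y0 IH.
have h0 : 0 <= y * (y * exp_term m (x + y)).
  by apply: mulr_ge0 => //; apply: mulr_ge0 => //; apply: exp_term_ge0; exact: addr_ge0.
nra.
Qed.

(** * Comparison of the complete homogeneous polynomials with exponential series *)

Lemma pareto_meanS (R : realType) (m n : nat) :
  pareto_mean R m.+1 n.+1
    = pareto_mean R m.+1 n + pareto_mean R m n.+1 / n.+1%:R.
Proof. by rewrite /= big_ord_recr. Qed.

Lemma pareto_mean_n0 (R : realType) (m : nat) : pareto_mean R m.+1 0 = 0.
Proof. by rewrite /= big_ord0. Qed.

(** The generating series is the product of the 1/(1 - z/k), each coefficientwise at least
    e^(z/k). *)
Lemma pareto_mean_ge (R : realType) (m n : nat) :
  exp_term m (harm R n) <= pareto_mean R m n.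
Proof.
elim: m n => [|m IHm] n; first by rewrite /exp_term expr0 divr1.
elim: n => [|n IHn].
  by rewrite pareto_mean_n0 /exp_term /harm big_ord0 exprS !mul0r.
rewrite pareto_meanS harmS.
apply: le_trans (exp_termD_le _ (harm_ge0 R n) _) _; first by rewrite invr_ge0.
by rewrite lerD // mulrC ler_wpM2r ?invr_ge0 // -harmS.
Qed.

(* The coefficient of z^m in e^(z H) / (1 - C z^2). *)
Fixpoint pareto_bound (R : realType) (m : nat) (H C : R) : R :=
  match m with
  | 0 => 1
  | 1 => H
  | m'.+2 => exp_term m'.+2 H + C * pareto_bound m' H C
  end.

Lemma pareto_boundSS (R : realType) (m : nat) (H C : R) :
  pareto_bound m.+2 H C = exp_term m.+2 H + C * pareto_bound m H C.
Proof. by []. Qed.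

Lemma nat_ind2 (P : nat -> Prop) :
  P 0%N -> P 1%N -> (forall n, P n -> P n.+1 -> P n.+2) -> forall n, P n.
Proof.
move=> P0 P1 PS n; suff [] : P n /\ P n.+1 by [].
by elim: n => [//|n [Pn PSn]]; split=> //; exact: PS.
Qed.

Lemma pareto_bound_ge0 (R : realType) (m : nat) (H C : R) : 0 <= H -> 0 <= C ->
  0 <= pareto_bound m H C.
Proof.
move=> H0 C0; elim/nat_ind2: m => //= m IH _.
by apply: addr_ge0; [exact: exp_term_ge0 | exact: mulr_ge0].
Qed.

(** Coefficientwise, e^(xz) >= 1 + xz, while 1/(1 - C z^2) increases with C. *)
Lemma pareto_boundD (R : realType) (m : nat) (H C x : R) :
  0 <= H -> 0 <= C -> 0 <= x ->
  pareto_bound m.+1 H C + x * pareto_bound m H C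
    <= pareto_bound m.+1 (H + x) (C + x ^+ 2).
Proof.
move=> H0 C0 x0; have Hx := addr_ge0 H0 x0; have x20 : 0 <= x ^+ 2 := sqr_ge0 x.
elim/nat_ind2: m => [||m IH _].
- by rewrite /= mulr1.
- have := exp_termD_ge 1 H0 x0; rewrite /= /exp_term expr1 !divr1; lra.
have E := exp_termD_ge m.+2 H0 x0.
have P0 := pareto_bound_ge0 m.+1 Hx (addr_ge0 C0 x20).
have := ler_wpM2l C0 IH; have := mulr_ge0 x20 P0.
rewrite (pareto_boundSS m.+1 H) (pareto_boundSS m.+1 (H + x)) (pareto_boundSS m H).
move: E; set X := pareto_bound m.+1 _ _; set Y := pareto_bound m _ _.
set Z := pareto_bound m.+1 _ _; lra.
Qed.

(* Two applications of the recurrence of pareto_mean, i.e. the factor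
   (1 + x z)/(1 - x^2 z^2), so that every term has a nonnegative sign. *)
Lemma pareto_boundS (R : realType) (m : nat) (H C x : R) :
  0 <= H -> 0 <= C -> 0 <= x ->
  pareto_bound m.+2 H C + x * pareto_bound m.+1 H C
      + x ^+ 2 * pareto_bound m (H + x) (C + x ^+ 2)
    <= pareto_bound m.+2 (H + x) (C + x ^+ 2).
Proof.
move=> H0 C0 x0; have E := exp_termD_ge m.+1 H0 x0.
case: m E => [|m] E.
  by move: E; rewrite /= /exp_term !expr1 !divr1; lra.
have := ler_wpM2l C0 (pareto_boundD m H0 C0 x0).
rewrite (pareto_boundSS m.+1 H) (pareto_boundSS m.+1 (H + x)) (pareto_boundSS m H).
move: E; set X := pareto_bound m.+1 _ _; set Y := pareto_bound m _ _.
set Z := pareto_bound m.+1 _ _; lra.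
Qed.

Definition harm2 (R : realType) (n : nat) : R := \sum_(k < n) k.+1%:R^-1 ^+ 2.

Lemma harm2_ge0 (R : realType) (n : nat) : 0 <= harm2 R n.
Proof. by rewrite sumr_ge0 // => k _; rewrite sqr_ge0. Qed.

Lemma harm2S (R : realType) (n : nat) :
  harm2 R n.+1 = harm2 R n + n.+1%:R^-1 ^+ 2.
Proof. by rewrite /harm2 big_ord_recr. Qed.

Lemma harm2_le2 (R : realType) (n : nat) : harm2 R n <= 2.
Proof.
case: n => [|n]; first by rewrite /harm2 big_ord0.
(* Strengthened for the induction, which telescopes 1/(x+1)^2 <= 1/x - 1/(x+1). *)
suff : harm2 R n.+1 <= 2 - n.+1%:R^-1.
  by move/le_trans; apply; rewrite gerBl invr_ge0.
elim: n => [|n IH]; first by rewrite harm2S /harm2 big_ord0 invr1 expr1n; lra.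
rewrite harm2S -(natr1 n.+1); move: IH; set x : R := n.+1%:R => IH.
have x1 : 1 <= x by rewrite ler1n.
clearbody x.
suff : x^-1 - (x + 1)^-1 - (x + 1)^-1 ^+ 2 >= 0 by lra.
have -> : x^-1 - (x + 1)^-1 - (x + 1)^-1 ^+ 2 = (x * (x + 1) ^+ 2)^-1.
  by field; apply/andP; split; lra.
by rewrite invr_ge0 mulr_ge0 ?sqr_ge0; lra.
Qed.

Lemma pareto_mean_le_bound (R : realType) (m n : nat) :
  pareto_mean R m n <= pareto_bound m (harm R n) (harm2 R n).
Proof.
elim: n m => [|n IHn] m.
  case: m => [//|m]; rewrite pareto_mean_n0.
  by rewrite pareto_bound_ge0 ?harm_ge0 ?harm2_ge0.
elim/nat_ind2: m => [//||m IHm _].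
  by rewrite pareto_meanS harmS /= div1r lerD2r; exact: (IHn 1%N).
(* Used twice, the recurrence gives h_(m+2)(n+1) = h_(m+2)(n) + x h_(m+1)(n) + x^2 h_m(n+1): the
   induction on n covers the first two terms, that on m the last. *)
rewrite !pareto_meanS; set x : R := n.+1%:R^-1.
have x0 : 0 <= x by rewrite invr_ge0.
have := pareto_boundS m (harm_ge0 R n) (harm2_ge0 R n) x0.
rewrite -harmS -harm2S => /(le_trans _); apply.
rewrite mulrDl addrA [_ * x]mulrC -[_ * x * x]mulrA -expr2 [_ * x ^+ 2]mulrC.
by rewrite !lerD // ?ler_wpM2l ?sqr_ge0.
Qed.

(** Lowering the degree from m+2 to m multiplies [exp_term] by (m+1)(m+2)/H^2 <= M^2/H^2, so the
    terms are dominated by a geometric series of ratio C M^2/H^2. *)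
Lemma pareto_bound_le (R : realType) (M m : nat) (H C : R) :
  0 < H -> 0 <= C -> C * M%:R ^+ 2 / H ^+ 2 < 1 -> (m <= M)%N ->
  pareto_bound m H C <= exp_term m H / (1 - C * M%:R ^+ 2 / H ^+ 2).
Proof.
move=> H0 C0; set q := _ / _ => q1.
have q0 : 0 <= q by rewrite divr_ge0 ?mulr_ge0 ?sqr_ge0 ?(ltW H0).
have q1' : 0 < 1 - q by rewrite subr_gt0.
have weak k : exp_term k H <= exp_term k H / (1 - q).
  rewrite ler_peMr ?exp_term_ge0 ?(ltW H0) // invf_ge1 //; lra.
elim/nat_ind2: m => [||m IH _] mM.
- by apply: le_trans (weak 0%N); rewrite /exp_term expr0 divr1.
- by apply: le_trans (weak 1%N); rewrite /exp_term expr1 divr1.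
have {}IH := IH (ltnW (ltnW mM)).
have Em : C * exp_term m H <= q * exp_term m.+2 H.
  have -> : exp_term m H = exp_term m.+2 H * (m.+1%:R * m.+2%:R) / H ^+ 2.
    apply: (canRL (mulfK _)); first by rewrite expf_neq0 // gt_eqF.
    rewrite mulrCA mulrA [_ * exp_term _ _]mulrC [m.+1%:R * m.+2%:R]mulrC.
    rewrite mulrA exp_termS -mulrA exp_termS; ring.
  rewrite /q; set e := exp_term m.+2 H.
  have e0 : 0 <= e by rewrite exp_term_ge0 // ltW.
  clearbody e.
  have -> : C * (e * (m.+1%:R * m.+2%:R) / H ^+ 2) = (C * e / H ^+ 2) * (m.+1%:R * m.+2%:R).
    by field; rewrite gt_eqF.
  have -> : C * M%:R ^+ 2 / H ^+ 2 * e = (C * e / H ^+ 2) * M%:R ^+ 2.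
    by field; rewrite gt_eqF.
  apply: ler_wpM2l; first by rewrite ?divr_ge0 ?mulr_ge0 ?exprn_ge0 ?(ltW H0).
  by rewrite -natrM -natrX ler_nat expnS expn1 leq_mul // ltnW.
apply: (@le_trans _ _ (exp_term m.+2 H + C * exp_term m H / (1 - q))).
  by rewrite /= lerD2l -mulrA ler_wpM2l.
rewrite ler_pdivlMr // mulrDl divfK ?gt_eqF //; lra.
Qed.

Lemma pareto_ratio_ge (R : realType) (m n : nat) : (1 < n)%N ->
  1 <= m`!%:R / ln n%:R ^+ m * pareto_mean R m n.
Proof.
move=> n1; have L0 : 0 < ln n%:R :> R by rewrite ln_gt0 // ltr1n.
have f0 : 0 < m`!%:R :> R by rewrite ltr0n fact_gt0.
have /andP[LH _] : ln n%:R <= harm R n <= 1 + ln n%:R by rewrite harm_ln // ltnW.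
apply: le_trans (ler_wpM2l _ (pareto_mean_ge R m n)); last first.
  by rewrite divr_ge0 ?exprn_ge0 ?ltW.
have -> : m`!%:R / ln n%:R ^+ m * exp_term m (harm R n) = (harm R n / ln n%:R) ^+ m.
  by rewrite /exp_term expr_div_n; field; rewrite expf_neq0 ?gt_eqF.
by rewrite exprn_ege1 // ler_pdivlMr // mul1r.
Qed.

(** With L = ln n, (H/L)^m <= (1 + 1/L)^m <= e^(m/L) <= e^t, and the geometric ratio is at most 2
    t^2 because [harm2] is at most 2 and m <= t H. *)
Lemma pareto_ratio_le (R : realType) (m n : nat) (t : R) : (1 < n)%N ->
  m%:R <= t * ln n%:R -> 2 * t ^+ 2 < 1 ->
  m`!%:R / ln n%:R ^+ m * pareto_mean R m n <= expR t / (1 - 2 * t ^+ 2).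
Proof.
move=> n1; have L0 : 0 < ln n%:R :> R by rewrite ln_gt0 // ltr1n.
have f0 : 0 < m`!%:R :> R by rewrite ltr0n fact_gt0.
have /andP[] : ln n%:R <= harm R n <= 1 + ln n%:R by rewrite harm_ln // ltnW.
set L := ln n%:R in L0 *; set H := harm R n => LH HL mt t1.
have H0 : 0 < H := lt_le_trans L0 LH.
have H0' := ltW H0; have L0' := ltW L0.
have t0 : 0 <= t by rewrite -(pmulr_lge0 _ L0) (le_trans _ mt).
have qt : harm2 R n * m%:R ^+ 2 / H ^+ 2 <= 2 * t ^+ 2.
  rewrite ler_pdivrMr ?exprn_gt0 // -mulrA ler_pM ?harm2_ge0 ?sqr_ge0 ?harm2_le2 //.
  rewrite -exprMn; have mtH : m%:R <= t * H by apply: le_trans mt _; apply: ler_wpM2l.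
  by apply: lerXn2r; rewrite ?nnegrE // (le_trans _ mtH).
have B := pareto_bound_le H0 (harm2_ge0 R n) (le_lt_trans qt t1) (leqnn m).
have {B} := le_trans (pareto_mean_le_bound R m n) B.
move/(ler_wpM2l (divr_ge0 (ltW f0) (exprn_ge0 m L0'))) => /le_trans; apply.
have -> : m`!%:R / L ^+ m * (exp_term m H / (1 - harm2 R n * m%:R ^+ 2 / H ^+ 2))
    = (H / L) ^+ m / (1 - harm2 R n * m%:R ^+ 2 / H ^+ 2).
  rewrite mulrA; congr (_ / _); rewrite /exp_term expr_div_n.
  by field; rewrite expf_neq0 ?gt_eqF.
apply: ler_pM.
- by rewrite exprn_ge0 // divr_ge0.
- by rewrite invr_ge0 subr_ge0 (le_trans qt) // ltW.
- apply: (@le_trans _ _ (expR L^-1 ^+ m)).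
    apply: lerXn2r; rewrite ?nnegrE ?divr_ge0 ?expR_ge0 //.
    apply: le_trans (expR_ge1Dx _); rewrite ler_pdivrMr // mulrDl mulVf ?gt_eqF //.
    by rewrite mul1r addrC.
  by rewrite -expRM_natr ler_expR mulrC ler_pdivrMr.
- rewrite lef_pV2 ?posrE ?subr_gt0 //; first by rewrite lerD2l lerN2.
  exact: le_lt_trans qt t1.
Qed.

(** For m+2 rows, this makes the loss (m+2)^2 negligible after normalization. Each step of the
    induction multiplies the left side by (m+3)^2 / ((m+2) L), which is at most 1. *)
Lemma fact_ratio_le (R : realType) (m : nat) (L : R) : 4 * m.+1%:R <= L ->
  m.+2%:R ^+ 2 * (m.+1`!%:R / L ^+ m.+1) <= 4 / L.
Proof.
elim: m => [|m IH] mL.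
  by rewrite (_ : 1`! = 1)%N // expr1 div1r -natrX lexx.
have a0 : 0 <= m%:R :> R by [].
move: mL; rewrite -(natr1 m.+1) -(natr1 m) => mL.
have L0 : 0 < L by lra.
apply: le_trans (IH _); last by rewrite -natr1; lra.
rewrite factS natrM -(natr1 m.+2) -(natr1 m.+1) -(natr1 m) (exprS L).
have F0 : 0 <= m.+1`!%:R / L ^+ m.+1 by rewrite divr_ge0 ?exprn_ge0 // ltW.
have P0 : L ^+ m.+1 != 0 by rewrite expf_neq0 ?gt_eqF.
move: F0 P0; set a : R := m%:R in a0 mL *.
move: (m.+1`!%:R) (L ^+ m.+1) => u v uv0 v0.
have -> : (a + 1 + 1 + 1) ^+ 2 * ((a + 1 + 1) * u / (L * v))
   = ((a + 1 + 1 + 1) ^+ 2 * (a + 1 + 1) / L) * (u / v).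
  by field; rewrite v0 gt_eqF.
rewrite ler_wpM2r // ler_pdivrMr //.
apply: (@le_trans _ _ ((a + 1 + 1) ^+ 2 * (4 * (a + 1 + 1)))).
  have a2 : 0 <= a ^+ 2 := sqr_ge0 a; have a3 : 0 <= a ^+ 3 := exprn_ge0 3 a0.
  clearbody a; rewrite -subr_ge0.
  rewrite (_ : _ - _ = 3 * a ^+ 3 + 16 * a ^+ 2 + 27 * a + 14); [lra | ring].
by rewrite ler_wpM2l ?sqr_ge0.
Qed.

(** L^m/m! = 4^m (L/4)^m/m! <= e^(2m) e^(L/4), and 2m <= L/4. For L = ln n the bound is the square
    root of n. *)
Lemma exp_term_le_expR (R : realType) (m : nat) (L : R) : 8 * m%:R <= L ->
  exp_term m L <= expR (L / 2).
Proof.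
move=> mL; have L0 : 0 <= L by apply: le_trans mL; rewrite mulr_ge0.
have e4 : 4 <= expR 2 :> R.
  have -> : 4 = (1 + 1) * (1 + 1) :> R by ring.
  have -> : 2 = 1 + 1 :> R by ring.
  by rewrite expRD ler_pM ?expR_ge1Dx // addr_ge0.
have -> : exp_term m L = 4 ^+ m * exp_term m (L / 4).
  by rewrite /exp_term expr_div_n; field; rewrite expf_neq0 //= pnatr_eq0 -lt0n fact_gt0.
have -> : expR (L / 2) = expR (L / 4) * expR (L / 4) by rewrite -expRD; congr expR; lra.
apply: ler_pM; rewrite ?exprn_ge0 ?exp_term_ge0 ?divr_ge0 //.
  apply: (@le_trans _ _ (expR 2 ^+ m)); first by apply: lerXn2r; rewrite ?nnegrE ?expR_ge0.
  by rewrite -expRM_natr ler_expR; lra.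
case: m {mL} => [|m].
  by rewrite /exp_term expr0 divr1 -expR0 ler_expR divr_ge0.
apply: le_trans (expR_ge1Dxn m _); last by rewrite divr_ge0.
by rewrite lerDr.
Qed.

(** * Decay of the row loss, uniformly in m *)

Lemma expn_le_2expn (d m : nat) : (0 < d)%N -> (m ^ d <= d ^ d * 2 ^ m)%N.
Proof.
(* With q the quotient of m by d, m <= d (q+1) <= d 2^q. *)
move=> d0; apply: (@leq_trans ((d * 2 ^ (m %/ d)) ^ d)).
  rewrite leq_exp2r // ltnW // (leq_trans (ltn_ceil m d0)) //.
  by rewrite mulnC leq_mul2l ltn_expl // orbT.
by rewrite expnMn -expnM leq_mul2l leq_pexp2l ?orbT // leq_trunc_div.
Qed.

Lemma row_loss_ge0 (R : realType) (m n : nat) : 0 <= row_loss R m n.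
Proof.
apply: mulr_ge0; first exact: exprn_ge0.
by apply: divr_ge0 => //; apply: sumr_ge0 => f _; rewrite exprn_ge0 ?invr_ge0.
Qed.

Lemma records_pgf_ge0 (R : realType) (n : nat) : 0 <= records_pgf R n.
Proof. by apply: divr_ge0 => //; apply: sumr_ge0 => u _; rewrite exprn_ge0 ?invr_ge0. Qed.

(** The eighth power keeps exponents integral. If m^8 <= n, the records give (m^2 n^(-1/2))^8 <=
    n^-2; if n < m^8, the loss is at most 2 m^18 2^-m, so the loss times m is bounded. *)
Lemma row_loss_exp8_le (R : realType) : exists K : R,
  forall m n, (2 <= m <= n)%N -> row_loss R m n ^+ 8 <= K / n%:R.
Proof.
(* The exponent 19 is 2 from the factor m^2, 16 from n^2 <= m^16, and 1 from the extra factor m. *)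
have [D mD] : exists D, forall m, (m ^ 19 <= D * 2 ^ m)%N.
  by exists (19 ^ 19)%N => m; exact: expn_le_2expn.
have K0 : 0 <= (2 * D%:R) ^+ 8 :> R by rewrite exprn_ge0 ?mulr_ge0.
exists (1 + (2 * D%:R) ^+ 8).
move=> m n /andP[m2 mn]; set r := row_loss R m n.
have r0 : 0 <= r := row_loss_ge0 R m n.
have n0 : 0 < n%:R :> R by rewrite ltr0n (leq_trans _ mn) // ltnW.
have m0 : 0 < m%:R :> R by rewrite ltr0n ltnW.
rewrite mulrDl; have [m8|m8] := leqP (m ^ 8)%N n.
  apply: (@le_trans _ _ (1 / n%:R)); last by rewrite lerDl divr_ge0 // ltW.
  apply: (@le_trans _ _ ((m%:R ^+ 2 * records_pgf R n) ^+ 8)).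
    by apply: lerXn2r; rewrite ?nnegrE ?row_loss_le_records // (le_trans r0) ?row_loss_le_records.
  rewrite exprMn -exprM (_ : 2 * 8 = 8 * 2)%N // exprM -natrX.
  rewrite (_ : 8 = 2 * 4)%N // [records_pgf R n ^+ _]exprM.
  apply: (@le_trans _ _ (n%:R ^+ 2 * n.+1%:R^-1 ^+ 4)).
    apply: ler_pM; rewrite ?exprn_ge0 ?sqr_ge0 ?records_pgf_ge0 //.
      by apply: lerXn2r; rewrite ?nnegrE ?ler_nat.
    by apply: lerXn2r; rewrite ?nnegrE ?sqr_ge0 ?invr_ge0 ?records_pgf_sqr.
  rewrite ler_pdivlMr // mulrAC -exprSr exprVn ler_pdivrMr ?exprn_gt0 // mul1r.
  rewrite -!natrX ler_nat (@leq_trans (n.+1 ^ 3)) ?leq_exp2r //.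
  by rewrite leq_pexp2l.
apply: (@le_trans _ _ ((2 * D%:R) ^+ 8 / n%:R)); last by rewrite lerDr divr_ge0 // ltW.
rewrite ler_pdivlMr //; apply: (@le_trans _ _ ((r * m%:R) ^+ 8)).
  by rewrite [(r * m%:R) ^+ 8]exprMn ler_wpM2l ?exprn_ge0 // -natrX ler_nat ltnW.
have rm0 : 0 <= r * m%:R by apply: mulr_ge0 => //; exact: ltW.
suff rmD : r * m%:R <= 2 * D%:R.
  by apply: lerXn2r => //; rewrite nnegrE (le_trans rm0).
have rle := row_loss_le_card R m n; rewrite -/r in rle.
apply: (le_trans (ler_wpM2r (ltW m0) rle)).
set p : R := 2^-1 ^+ m; have p0 : 0 <= p by rewrite exprn_ge0 ?invr_ge0.
have pn : 2^-1 ^+ n <= p by apply: ler_wiXn2l => //; rewrite ?invr_ge0 ?invf_le1 ?ler1n.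
have n1 : 1 <= n%:R ^+ 2 :> R by rewrite -natrX ler1n expn_gt0 -(ltr0n R) n0.
have h16 : n%:R ^+ 2 <= m%:R ^+ 16 :> R.
  by rewrite (_ : 16 = 8 * 2)%N // exprM; apply: lerXn2r; rewrite ?nnegrE ?exprn_ge0 // -natrX ler_nat ltnW.
have hp : m%:R ^+ 19 * p <= D%:R.
  rewrite /p exprVn ler_pdivrMr ?exprn_gt0 // -!natrX -natrM ler_nat; exact: mD.
apply: (@le_trans _ _ (m%:R ^+ 2 * (2 * m%:R ^+ 16 * p) * m%:R)).
  rewrite ler_wpM2r ?(ltW m0) // ler_wpM2l ?sqr_ge0 //.
  apply: (@le_trans _ _ (p + n%:R ^+ 2 * p)); first by rewrite lerD2r.
  have := ler_wpM2r p0 n1; have := ler_wpM2r p0 h16; lra.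
rewrite (_ : _ * m%:R = 2 * (m%:R ^+ 19 * p)); last ring.
by rewrite ler_wpM2l.
Qed.

(** * Limits *)

Lemma expR_ratio_le (R : realType) (t : R) : 0 < t -> t <= 4^-1 ->
  expR t / (1 - 2 * t ^+ 2) <= 1 + 4 * t.
Proof.
move=> t0 t4.
have e1 : expR t * (1 - t) <= 1.
  have := ler_wpM2l (expR_ge0 t) (expR_ge1Dx (- t)).
  by rewrite -expRD subrr expR0.
have e0 := expR_ge0 t.
have t2 : 2 * t ^+ 2 <= t / 2 by rewrite expr2; nra.
rewrite ler_pdivrMr; last lra.
have : expR t <= 1 + 2 * t by nra.
by rewrite expr2; nra.
Qed.

Lemma ln_nat_gt0 (R : realType) (n : nat) : (1 < n)%N -> 0 < ln n%:R :> R.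
Proof. by move=> n1; rewrite ln_gt0 // ltr1n. Qed.

Lemma Expect_SC_ratio_ge (R : realType) (m n : nat) : (1 < m)%N -> (1 < n)%N ->
  4 * m%:R <= ln n%:R :> R ->
  1 - 4 / ln n%:R
    <= m.-1`!%:R / ln n%:R ^+ m.-1 * Expect (fun g : game m n => (SC g)%:R) :> R.
Proof.
case: m => [|[|m]] // _ n1 mL; have L0 := ln_nat_gt0 R n1.
set c : R := _ / ln n%:R ^+ _; have c0 : 0 <= c by rewrite divr_ge0 ?exprn_ge0 ?ltW.
apply: le_trans _ (ler_wpM2l c0 (Expect_SC_ge_pareto R m.+1 (ltnW n1))).
rewrite mulrBr lerB ?pareto_ratio_ge // mulrC fact_ratio_le //.
by apply: le_trans mL; rewrite ler_wpM2l // ler_nat.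
Qed.

Lemma Expect_SC_ratio_le (R : realType) (m n : nat) (t : R) :
  (1 < m)%N -> (1 < n)%N -> 0 < t -> t <= 4^-1 -> m%:R <= t * ln n%:R ->
  m.-1`!%:R / ln n%:R ^+ m.-1 * Expect (fun g : game m n => (SC g)%:R) <= 1 + 4 * t.
Proof.
case: m => [|m] // _ n1 t0 t4 mt; have L0 := ln_nat_gt0 R n1.
have c0 : 0 <= m`!%:R / ln n%:R ^+ m :> R by rewrite divr_ge0 ?exprn_ge0 ?ltW.
apply: le_trans (ler_wpM2l c0 (Expect_SC_le R m (ltnW n1))) _.
apply: le_trans (expR_ratio_le t0 t4); apply: pareto_ratio_le => //.
  by apply: le_trans mt; rewrite ler_nat.
by rewrite expr2; nra.
Qed.

Lemma Expect_SC_ge0 (R : realType) (m n : nat) :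
  0 <= Expect (fun g : game m n => (SC g)%:R) :> R.
Proof.
rewrite game_avg; apply: divr_ge0 => //; apply: sumr_ge0 => f _.
by apply: divr_ge0 => //; apply: sumr_ge0.
Qed.

(** The ratio bound at t = 1/4 gives a mean of at most 2 L^(m-1)/(m-1)! <= 2 e^(L/2) with L = ln n;
    since n = e^L, what remains is L/2 <= e^(L/2). *)
Lemma Expect_SC_div_le (R : realType) (m n : nat) :
  (1 < m)%N -> (1 < n)%N -> 8 * m%:R <= ln n%:R :> R ->
  Expect (fun g : game m n => (SC g)%:R) / n%:R <= 4 / ln n%:R :> R.
Proof.
move=> m1 n1 mL; have L0 := ln_nat_gt0 R n1.
have n0 : 0 < n%:R :> R by rewrite ltr0n ltnW.
have := @Expect_SC_ratio_le R m n 4^-1 m1 n1.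
set E := Expect _; set L := ln _ in L0 mL *; set k := m.-1 => /(_ _ _ _) h.
have {h} h : k`!%:R / L ^+ k * E <= 2.
  by apply: le_trans (h _ _ _) _; have : 0 <= m%:R :> R by []; lra.
have k8 : 8 * k%:R <= L.
  by apply: le_trans mL; rewrite ler_wpM2l // ler_nat leq_pred.
have {h} h : E <= 2 * expR (L / 2).
  apply: le_trans (_ : 2 * exp_term k L <= _); last by rewrite ler_wpM2l ?exp_term_le_expR.
  rewrite /exp_term mulrA ler_pdivlMr ?ltr0n ?fact_gt0 //.
  by move: h; rewrite mulrAC ler_pdivrMr ?exprn_gt0 // mulrC.
have nE : n%:R = expR (L / 2) * expR (L / 2).
  by rewrite -expRD -splitr /L lnK // posrE.
have e0 := expR_gt0 (L / 2).
have eL : L / 2 <= expR (L / 2) by apply: le_trans (expR_ge1Dx _); lra.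
rewrite ler_pdivrMr // mulrAC ler_pdivlMr // nE.
apply: le_trans (ler_wpM2r (ltW L0) h) _.
by nra.
Qed.

Local Open Scope classical_set_scope.
Local Open Scope ring_scope.

Lemma near_ln_gt (R : realType) (A : R) : \forall n \near \oo, A < ln n%:R.
Proof.
near=> n; rewrite -[A]expRK ltr_ln ?posrE ?expR_gt0 //.
  by near: n; exact: nbhs_infty_gtr.
by rewrite ltr0n; near: n; exact: nbhs_infty_gt.
Unshelve. all: end_near. Qed.

Lemma row_loss_cvg0 (R : realType) (m : nat -> nat) :
  (forall n, (2 <= n)%N -> (2 <= m n <= n)%N) ->
  row_loss R (m n) n @[n --> \oo] --> (0 : R).
Proof.
move=> hm; have [K rK] := row_loss_exp8_le R.
apply/cvgr0Pnorm_lt => e e0; have e8 : 0 < e ^+ 8 by rewrite exprn_gt0.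
near=> n.
have n2 : (2 <= n)%N by near: n; exact: nbhs_infty_ge.
have n0 : 0 < n%:R :> R by rewrite ltr0n ltnW.
have nK : K / e ^+ 8 < n%:R by near: n; exact: nbhs_infty_gtr.
have r0 := row_loss_ge0 R (m n) n.
rewrite ger0_norm // ltNge; apply/negP => er.
have : e ^+ 8 <= row_loss R (m n) n ^+ 8 by apply: lerXn2r; rewrite ?nnegrE // ltW.
move/le_trans/(_ (rK _ _ (hm n n2))); apply/negP; rewrite -ltNge.
by rewrite ltr_pdivrMr // mulrC -ltr_pdivrMr.
Unshelve. all: end_near. Qed.

Lemma nat_div_2exp_cvg0 (R : realType) (m : nat -> nat) :
  ((m n)%:R - ln n%:R / ln 2 : R) @[n --> \oo] --> +oo ->
  n%:R * 2^-1 ^+ m n @[n --> \oo] --> (0 : R).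
Proof.
move=> /cvgryPgt dm; have l2 : 0 < ln 2 :> R by rewrite ln_gt0 // ltr1n.
apply/cvgr0Pnorm_lt => e e0; near=> n.
have n0 : 0 < n%:R :> R by rewrite ltr0n; near: n; exact: nbhs_infty_gt.
(* With d = m ln 2 - ln n, the quantity is e^(-d); this threshold makes d exceed 1/e for the
   tolerance [e], and exp(d) >= 1 + d. *)
have : (e * ln 2)^-1 < (m n)%:R - ln n%:R / ln 2 by near: n; exact: dm.
rewrite invfM ltr_pdivrMr // mulrBl divfK ?gt_eqF // => d.
rewrite ger0_norm ?mulr_ge0 ?exprn_ge0 ?invr_ge0 //.
have -> : n%:R * 2^-1 ^+ m n = (expR ((m n)%:R * ln 2 - ln n%:R))^-1 :> R.
  rewrite expRD expRN lnK ?posrE // expRM_natl lnK ?posrE // exprVn.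
  by rewrite invfM invrK mulrC.
rewrite invf_plt ?posrE ?expR_gt0 // (lt_le_trans d) //.
by apply: le_trans (expR_ge1Dx _); rewrite lerDr.
Unshelve. all: end_near. Qed.


Theorem theorem2 (R : realType) (m : nat -> nat)
    (hm : forall n : nat, (2 <= n)%N -> (2 <= m n <= n)%N) :
  [/\ Prob R (fun g : game (m n) n => (SR g < m n)%N) @[n --> \oo] --> (0 : R),
      (fun n : nat => (m n)%:R : R^o) =o_\oo (fun n : nat => ln n%:R : R^o) ->
        (((m n).-1)`!%:R / ln n%:R ^+ (m n).-1
           * Expect (fun g : game (m n) n => (SC g)%:R)) @[n --> \oo] --> (1 : R)
        /\ (Expect (fun g : game (m n) n => (SC g)%:R) / n%:R) @[n --> \oo] --> (0 : R)
    & ((m n)%:R - ln n%:R / ln 2 : R) @[n --> \oo] --> +oo ->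
        (Expect (fun g : game (m n) n => (SC g)%:R) / n%:R) @[n --> \oo] --> (1 : R)].
Proof.
have m2 n : (2 <= n)%N -> (1 < m n)%N by move=> /hm /andP[].
have m0 n : (2 <= n)%N -> (0 < m n)%N by move=> /m2 /ltnW.
have loss0 := @row_loss_cvg0 R m hm.
split.
- apply: (@squeeze_cvgr _ _ _ _ (fun=> 0) (fun n => row_loss R (m n) n)) => //.
    near=> n; have n2 : (2 <= n)%N by near: n; exact: nbhs_infty_ge.
    rewrite Prob_SR_lt ?m0 // andbT Prob_Expect game_avg.
    apply: divr_ge0 => //; apply: sumr_ge0 => f _.
    by apply: divr_ge0 => //; apply: sumr_ge0.
  exact: cvg_cst.
- move=> /eqoP mo.
  have mL (t : R) : 0 < t -> \forall n \near \oo, (m n)%:R <= t * ln n%:R.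
    move=> t0; near=> n.
    have n2 : (2 <= n)%N by near: n; exact: nbhs_infty_ge.
    have : `|(m n)%:R : R^o| <= t * `|ln n%:R : R^o| by near: n; exact: mo.
    by rewrite !ger0_norm // ln_ge0 // ler1n ltnW.
  split.
    (* The bound 1/4 is what the upper estimate requires, and e/8 keeps its error 4t below e. *)
    apply/cvgrPdist_lt => e e0; pose t : R := Num.min 4^-1 (e / 8).
    have t0 : 0 < t by rewrite lt_min invr_gt0 ltr0n divr_gt0.
    have t4 : t <= 4^-1 by rewrite ge_min lexx.
    have te : t <= e / 8 by rewrite ge_min lexx orbT.
    near=> n.
    have n2 : (2 <= n)%N by near: n; exact: nbhs_infty_ge.
    have L0 := ln_nat_gt0 R n2.
    have mt : (m n)%:R <= t * ln n%:R by near: n; exact: mL.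
    have Le : 4 / e < ln n%:R by near: n; exact: near_ln_gt.
    have Le' : 4 / ln n%:R < e by rewrite ltr_pdivrMr // mulrC -ltr_pdivrMr.
    have up := Expect_SC_ratio_le (m2 _ n2) n2 t0 t4 mt.
    have m4 : 4 * (m n)%:R <= ln n%:R :> R.
      by have := ler_wpM2r (ltW L0) t4; lra.
    have lo := Expect_SC_ratio_ge (m2 _ n2) n2 m4.
    rewrite distrC ltr_norml; apply/andP; split; lra.
  apply/cvgr0Pnorm_lt => e e0; near=> n.
  have n2 : (2 <= n)%N by near: n; exact: nbhs_infty_ge.
  have L0 := ln_nat_gt0 R n2.
  have Le : 4 / e < ln n%:R by near: n; exact: near_ln_gt.
  have m8 : (m n)%:R <= 8^-1 * ln n%:R :> R by near: n; apply: mL; rewrite invr_gt0.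
  rewrite ger0_norm ?divr_ge0 ?Expect_SC_ge0 //.
  apply: le_lt_trans (Expect_SC_div_le (m2 _ n2) n2 _) _; first lra.
  by rewrite ltr_pdivrMr // mulrC -ltr_pdivrMr.
- move=> /nat_div_2exp_cvg0 exp0.
  (* The lower function is [Expect_SC_ge_card] divided by n; both of its error terms vanish. *)
  apply: (@squeeze_cvgr _ _ _ _
    (fun n => 1 - n%:R * 2^-1 ^+ m n - row_loss R (m n) n) (fun=> 1)).
  + near=> n; have n2 : (2 <= n)%N by near: n; exact: nbhs_infty_ge.
    have n0 : 0 < n%:R :> R by rewrite ltr0n ltnW.
    rewrite ler_pdivlMr // ler_pdivrMr // mul1r; apply/andP; split.
      apply: le_trans (Expect_SC_ge_card R n (m0 _ n2)).
      by rewrite le_eqVlt; apply/orP; left; apply/eqP; ring.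
    rewrite game_avg -[leRHS](avg_cst [ffun _ : 'I_(m n) => 1%g : 'S_n]).
    apply: ler_avg => f; rewrite -[leRHS](avg_cst [ffun _ : 'I_n => 1%g : 'S_(m n)]).
    by apply: ler_avg => h; rewrite ler_nat -[leqRHS](card_ord n) max_card.
  + rewrite -[X in _ --> X]subr0 -[X in _ --> X - _]subr0.
    by apply: cvgB => //; apply: cvgB => //; exact: cvg_cst.
  + exact: cvg_cst.
Unshelve. all: end_near. Qed.
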